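(* Let $I \subset R = K[\mathcal{A}]$ be a square-free monomial ideal and let $\mathcal{H} = \mathcal{H}(I) = (V,X,E,\mathcal{E})$ be its labeled hypergraph. Suppose that $\dim(\mathcal{H}) = 1$ and that there exist closed vertices $c_1,\ldots,c_t$ such that \begin{enumerate} \item for all $1 \le i < j \le t$, $c_i \notin N_{\mathcal{H}}(c_j)$; \item for every open vertex $v$, there exists $1 \le i \le t$ such that $c_i \in N_{\mathcal{H}}(v)$; \item for all $1 \le i \le t$, there is a unique $a \in X$ with $E_a = \{c_i\}$; \item all open vertices are isolated. \end{enumerate} Then \[\mathrm{reg}(R/I) = |X| - |V|.\]
   Context: $K$ is a field, $\mathcal{A}$ is a finite set of symbols regarded as variables, and $R = K[\mathcal{A}]$ is the polynomial ring with the standard grading (every variable has degree one). For a finitely generated graded $R$-module $M$ with graded Betti numbers $\beta_{ij}(M)$ (so that the $i$th module of the minimal graded free resolution is $\bigoplus_j R(-j)^{\beta_{ij}(M)}$), $\mathrm{reg}(M) = \max\{j-i : \beta_{ij}(M)\neq 0 \text{ for some } i\}$. Labeled hypergraph of an ideal: let $I\subset R$ be a square-free monomial ideal with minimal monomial generating set $\{f_1,\ldots,f_\mu\}$. Its labeled hypergraph is $\mathcal{H}(I) = (V,X,E,\mathcal{E})$ where $V = \{1,\ldots,\mu\}$; $E$ is the function from $\mathcal{A}$ to the power set of $V$ given by $E_a = E(a) = \{j : a \text{ divides } f_j\}$; $X = \{a\in\mathcal{A} : E_a\neq\emptyset\}$; and $\mathcal{E} = \mathrm{Im}(E)$ is the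 set of edges. The dimension is $\dim(\mathcal{H}) = \max\{|F|-1 : F\in\mathcal{E}\}$. A vertex $v\in V$ is closed if $\{v\}\in\mathcal{E}$, and open otherwise. The set of neighbors of $v$ is $N_{\mathcal{H}}(v) = \{w\in V : w\neq v \text{ and there is } F\in\mathcal{E} \text{ with } v,w\in F\}$. All open vertices are isolated means: for every open vertex $v$ and every $w\in N_{\mathcal{H}}(v)$, $w$ is closed. *)

(* Defs.v *)
From Stdlib Require Import ClassicalEpsilon.
From HB Require Import structures.
From mathcomp Require Import all_boot all_order all_algebra.
From mathcomp Require Import mpoly.

Set Implicit Arguments.
Unset Strict Implicit.
Unset Printing Implicit Defensive.

Import GRing.Theory.
Local Open Scope ring_scope.
Local Open Scope quotient_scope.

Section QuotientModule.
Variables (R : nzRingType) (M : lmodType R) (N : submodClosed M).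

Definition submod_pred : {pred M} := N.

HB.instance Definition _ := GRing.isZmodClosed.Build M submod_pred
  (GRing.submod_closedB (submodClosedP N)).

Definition quot_lmod := {ideal_quot submod_pred}.

HB.instance Definition _ := GRing.Zmodule.on quot_lmod.

Definition quot_proj (x : M) : quot_lmod := \pi_({ideal_quot submod_pred}) x.

Definition quot_scale (a : R) (u : quot_lmod) : quot_lmod :=
  quot_proj (a *: repr u).

Lemma quot_projD x y : quot_proj (x + y) = quot_proj x + quot_proj y.
Proof. exact: raddfD. Qed.

Lemma quot_proj_eq x y : (quot_proj x = quot_proj y) <-> (x - y \in N).
Proof.
split=> [/eqP | Nxy]; first by rewrite -Quotient.idealrBE.
by apply/eqP; rewrite -Quotient.idealrBE.
Qed.

Lemma quot_scale_proj a x : quot_scale a (quot_proj x) = quot_proj (a *: x).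
Proof.
apply/quot_proj_eq; rewrite -scalerBr rpredZ //.
by apply/quot_proj_eq; rewrite /quot_proj reprK.
Qed.

Lemma quot_projP u : {x | u = quot_proj x}.
Proof. by exists (repr u); rewrite /quot_proj reprK. Qed.

Lemma quot_scalerA a b u :
  quot_scale a (quot_scale b u) = quot_scale (a * b) u.
Proof. by case: (quot_projP u) => x ->; rewrite !quot_scale_proj scalerA. Qed.

Lemma quot_scale1r : left_id 1 quot_scale.
Proof. by move=> u; case: (quot_projP u) => x ->; rewrite quot_scale_proj scale1r. Qed.

Lemma quot_scalerDr : right_distributive quot_scale +%R.
Proof.
move=> a u v; case: (quot_projP u) => x ->; case: (quot_projP v) => y ->.
by rewrite -quot_projD !quot_scale_proj scalerDr quot_projD.
Qed.

Lemma quot_scalerDl u : {morph quot_scale^~ u : a b / a + b}.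
Proof.
move=> a b; case: (quot_projP u) => x ->.
by rewrite !quot_scale_proj scalerDl quot_projD.
Qed.

HB.instance Definition _ := GRing.Zmodule_isLmodule.Build R quot_lmod
  quot_scalerA quot_scale1r quot_scalerDr quot_scalerDl.

End QuotientModule.

Section GradedModules.
Variables (K : fieldType) (n : nat).
Local Notation R := {mpoly K[n]}.

(* Membership in the component R_d of the standard grading; R_d = 0 for d < 0. *)
Definition homog_of_degree (d : int) (p : R) : Prop :=
  match d with
  | Posz e => p \is e.-homog
  | Negz _ => p = 0
  end.

Section Resolutions.
Variables (M : lmodType R) (gr : int -> M -> Prop).

(* A sequence of free modules F_i = \bigoplus_k R(- shift i k) with bases of  *)
(* rank i homogeneous elements; the differential F_(i+1) -> F_i acts on row   *)
(* vectors by v |-> v *m diff i, and the augmentation F_0 -> M sends the k-th *)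
(* basis element to aug k.                                                    *)
Record free_complex := FreeComplex {
  rank : nat -> nat;
  shift : forall i, 'I_(rank i) -> int;
  diff : forall i, 'M[R]_(rank i.+1, rank i);
  aug : 'I_(rank 0) -> M
}.

Arguments shift : clear implicits.
Arguments diff : clear implicits.
Arguments aug : clear implicits.

Definition augmentation (F : free_complex) (v : 'rV[R]_(rank F 0)) : M :=
  \sum_k v 0 k *: aug F k.

Arguments augmentation : clear implicits.

Definition graded_complex (F : free_complex) : Prop :=
  (forall k, gr (shift F 0%N k) (aug F k)) /\
  (forall i k l,
     homog_of_degree (shift F i.+1 k - shift F i l) (diff F i k l)).

Definition exact_complex (F : free_complex) : Prop :=
  [/\ forall x : M, exists v, augmentation F v = x,
      forall v : 'rV_(rank F 0),
        augmentation F v = 0 <-> exists w, v = w *m diff F 0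
    & forall i (v : 'rV_(rank F i.+1)),
        v *m diff F i = 0 <-> exists w, v = w *m diff F i.+1].

(* The image of F_(i+1) lies in (x_1, ..., x_n) F_i. *)
Definition minimal_complex (F : free_complex) : Prop :=
  forall i k l, (diff F i k l)@_0%MM = 0.

Definition minimal_graded_free_resolution (F : free_complex) : Prop :=
  [/\ graded_complex F, exact_complex F & minimal_complex F].

Definition zero_complex : free_complex :=
  @FreeComplex (fun=> 0%N) (fun _ _ => 0) (fun=> 0) (fun=> 0).

(* Minimal graded free resolutions are unique up to isomorphism, so the       *)
(* choice made by epsilon is immaterial.                                      *)
Definition min_resolution : free_complex :=
  epsilon (inhabits zero_complex) minimal_graded_free_resolution.

Definition betti (i : nat) (j : int) : nat :=
  #|[set k : 'I_(rank min_resolution i) | shift min_resolution i k == j]|.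

(* r = max {j - i : betti i j != 0} *)
Definition is_reg (r : int) : Prop :=
  (exists i j, betti i j != 0%N /\ r = j - Posz i) /\
  (forall i j, betti i j != 0%N -> j - Posz i <= r).

End Resolutions.
End GradedModules.

Section CyclicModules.
Variables (K : fieldType) (n : nat).
Local Notation R := {mpoly K[n]}.

(* The grading of R/I induced by the standard grading of R. *)
Definition quot_grading (I : submodClosed R^o) (d : int) (x : quot_lmod I) :
    Prop :=
  exists2 p : R, homog_of_degree d p & x = quot_proj I p.

Definition monomials_generate (I : {pred R}) (S : 'X_{1..n} -> Prop) : Prop :=
  forall p : R, p \in I <->
    exists (k : nat) (m : 'I_k -> 'X_{1..n}) (c : 'I_k -> R),
      (forall i, S (m i)) /\ p = \sum_i c i * 'X_[m i].

Definition squarefree (m : 'X_{1..n}) : Prop := forall a, (m a <= 1)%N.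

Definition squarefree_monomial_ideal (I : {pred R}) : Prop :=
  exists S : 'X_{1..n} -> Prop,
    (forall m, S m -> squarefree m) /\ monomials_generate I S.

Definition minimal_monomial_generators (I : {pred R}) (mu : nat)
    (f : 'I_mu -> 'X_{1..n}) : Prop :=
  [/\ injective f,
      monomials_generate I (fun m => exists j, m = f j)
    & forall J : {set 'I_mu}, J \proper [set: 'I_mu] ->
        ~ monomials_generate I (fun m => exists2 j, j \in J & m = f j)].

(* The map a |-> {j : a divides f_j} from the variables to sets of vertices. *)
Definition label_map (mu : nat) (f : 'I_mu -> 'X_{1..n}) (a : 'I_n) :
    {set 'I_mu} :=
  [set j | (U_(a) <= f j)%MM].

End CyclicModules.

(* A labeled hypergraph on the vertex type V with symbols in A is given by    *)
(* its map E : A -> {set V}.                                                  *)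
Section LabeledHypergraphs.
Variables (A V : finType) (E : A -> {set V}).

Definition hg_labels : {set A} := [set a | E a != set0].

Definition hg_edges : {set {set V}} := [set E a | a : A].

Definition hg_dim : int := Posz (\max_(F in hg_edges) #|F|) - 1.

Definition hg_closed (v : V) : bool := [set v] \in hg_edges.

Definition hg_open (v : V) : bool := ~~ hg_closed v.

Definition hg_neighbors (v : V) : {set V} :=
  [set w | (w != v) && [exists F in hg_edges, (v \in F) && (w \in F)]].

Definition open_vertices_isolated : Prop :=
  forall v w, hg_open v -> w \in hg_neighbors v -> hg_closed w.

End LabeledHypergraphs.

(* Main.v *)
Require Import Defs.
From Stdlib Require Import ClassicalEpsilon.
From HB Require Import structures.
From mathcomp Require Import all_boot all_order all_algebra.
From mathcomp Require Import mpoly zify.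

(** Vertices of the hypergraph are the minimal generators, labels are the
variables, and a label lies in one or two vertices.  Call a set W of vertices
neighborhood-free if it contains the full set of neighbors of no open vertex.
These sets form a simplicial complex; labelling W by the least common multiple
of its generators gives a subcomplex of the Taylor complex of I.

It is a resolution of R/I.  In multidegree m the complex consists of the
neighborhood-free W all of whose generators divide m, and this is a cone
([cone_apexP]).  If the generator of some open vertex divides m, that vertex is
an apex: open vertices are isolated, so it is a neighbor of no open vertex.
Otherwise the generator of every open vertex v contains a variable that m
lacks; that variable is shared with a neighbor of v, whose generator does not
divide m either, so the condition defining neighborhood-free sets is automatic
and the complex is a full simplex.  The
resolution is minimal, because each u in a neighborhood-free W owns a variable
that no other generator of W has ([nbhd_free_private_label]): the label {u} if
u is closed, the label {u, x} with x a neighbor outside W if u is open.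

Two minimal graded resolutions have the same shifts in each homological degree
([resolution_shift]), so the shifts of this one compute the Betti numbers: the
regularity is the maximum of (number of labels meeting W) - |W| over
neighborhood-free W.  With U the complement of W, this equals |X| - |V| plus
|U| minus the number of labels inside U.  That correction is at most 0: a closed
u in U has a label {u}, an open u in U has a label {u, x} with x in U because W
does not contain all its neighbors, and x is closed by isolation, which makes
these labels distinct for distinct u.  The correction is 0 for
U = {c_1, ..., c_t}, whose complement is neighborhood-free because the c_i
dominate the open vertices: independence leaves only the labels {c_i} inside U,
one each. *)

Set Implicit Arguments.
Unset Strict Implicit.
Unset Printing Implicit Defensive.

Import GRing.Theory.
Local Open Scope ring_scope.

Local Arguments augmentation {K n M} F v.
Local Arguments shift {K n M} f i _.
Local Arguments aug {K n M} f _.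

(** * Homogeneous parts and graded matrices *)

Section HomogeneousParts.
Variables (K : fieldType) (n : nat).
Local Notation R := {mpoly K[n]}.

Definition hpart (d : int) (p : R) : R :=
  if d is Posz e then pihomog mdeg e p else 0.

Lemma hpart_linear d : linear (hpart d).
Proof.
case: d => e /= a p q; first exact: linearP.
by rewrite scaler0 addr0.
Qed.

HB.instance Definition _ d :=
  GRing.isLinear.Build K R R _ (hpart d) (hpart_linear d).

Lemma homog_hpart d p : homog_of_degree d (hpart d p).
Proof. by case: d => e //=; exact: pihomogP. Qed.

Lemma hpart_id d p : homog_of_degree d p -> hpart d p = p.
Proof. by case: d => e //= hp; rewrite pihomog_dE. Qed.

Lemma homog_of_degreeX (m : 'X_{1..n}) :
  homog_of_degree (mdeg m) ('X_[m] : R).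
Proof. by rewrite /= dhomogX. Qed.

Lemma hpartM d e p q : homog_of_degree e q ->
  hpart d (p * q) = hpart (d - e) p * q.
Proof.
case: e => [e|e] /= hq; last by rewrite hq !mulr0 linear0.
rewrite (mpolyE p) mulr_suml !linear_sum /= mulr_suml; apply: eq_bigr => m _.
rewrite -scalerAl !linearZ /= -scalerAl; congr (_ *: _).
have hm : 'X_[m] * q \is (mdeg m + e)%N.-homog by rewrite dhomogM ?dhomogX.
have [->|ne] := eqVneq d (Posz (mdeg m + e)).
  by rewrite PoszD addrK /= pihomog_dE // pihomogX eqxx.
have -> : hpart d ('X_[m] * q) = 0.
  case: d ne => d //= ne; rewrite (pihomog_ne0 _ hm) //.
  by apply: contraNneq ne => ->.
case E : (d - Posz e) => [k|k] /=; rewrite ?mul0r // pihomogX.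
case: eqP => [mk|_]; last by rewrite mul0r.
by case/eqP: ne; rewrite mk PoszD -E subrK.
Qed.

Lemma homog_of_degreeM d e (p q : R) :
  homog_of_degree d p -> homog_of_degree e q -> homog_of_degree (d + e) (p * q).
Proof.
case: d => d /=; last first.
  by move=> -> _; rewrite mul0r; case: (_ + e) => //= a; rewrite dhomog0.
case: e => e /=; first exact: dhomogM.
by move=> _ ->; rewrite mulr0; case: (_ + _) => //= a; rewrite dhomog0.
Qed.

Lemma homog_of_degree_sum (I : finType) (P : pred I) d (F : I -> R) :
  (forall i, P i -> homog_of_degree d (F i)) ->
  homog_of_degree d (\sum_(i | P i) F i).
Proof.
case: d => d /= hF; first by apply: rpred_sum => i Pi; exact: hF.
by rewrite big1.
Qed.

Definition graded_matrix p q (s : 'I_p -> int) (t : 'I_q -> int)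
  (A : 'M[R]_(p, q)) := forall k l, homog_of_degree (s k - t l) (A k l).

(** Taking homogeneous parts entrywise turns any factorization of a graded
matrix through a graded matrix into a graded one; this is what makes lifts
along graded differentials graded. *)
Lemma graded_mulmx_factor p q r s t u (A : 'M[R]_(p, q)) (B : 'M[R]_(p, r))
    (D : 'M[R]_(r, q)) :
  graded_matrix s t A -> graded_matrix u t D -> A = B *m D ->
  exists2 B', graded_matrix s u B' & A = B' *m D.
Proof.
move=> gA gD defA; exists (\matrix_(k, l) hpart (s k - u l) (B k l)).
  by move=> k l; rewrite mxE; exact: homog_hpart.
apply/matrixP => k l; rewrite -(hpart_id (gA k l)) defA !mxE linear_sum.
apply: eq_bigr => j _; rewrite [LHS](hpartM _ _ (gD j l)) !mxE.
congr (hpart _ _ * _).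
by rewrite opprB addrA subrK.
Qed.

Lemma graded_mulmx p q r s t u (A : 'M[R]_(p, q)) (B : 'M[R]_(q, r)) :
  graded_matrix s t A -> graded_matrix t u B -> graded_matrix s u (A *m B).
Proof.
move=> gA gB k l; rewrite mxE; apply: homog_of_degree_sum => j _.
by rewrite -(subrK (t j) (s k)) -addrA; apply: homog_of_degreeM.
Qed.

Definition in_irrelevant p q (A : 'M[R]_(p, q)) :=
  forall k l, (A k l)@_0%MM = 0.

Lemma in_irrelevant_mulmxl p q r (A : 'M[R]_(p, q)) (B : 'M[R]_(q, r)) :
  in_irrelevant A -> in_irrelevant (A *m B).
Proof.
move=> hA k l; rewrite mxE raddf_sum big1 // => j _.
by rewrite /= [LHS](rmorphM (mcoeff 0)) /= hA mul0r.
Qed.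

Lemma in_irrelevant_mulmxr p q r (A : 'M[R]_(p, q)) (B : 'M[R]_(q, r)) :
  in_irrelevant B -> in_irrelevant (A *m B).
Proof.
move=> hB k l; rewrite mxE raddf_sum big1 // => j _.
by rewrite /= [LHS](rmorphM (mcoeff 0)) /= hB mulr0.
Qed.

End HomogeneousParts.

(** * Uniqueness of the shifts of minimal graded resolutions *)

Section Uniqueness.
Variables (K : fieldType) (n : nat).
Local Notation R := {mpoly K[n]}.
Variables (M : lmodType R) (gr : int -> M -> Prop).

Lemma mulmx_diff_lift (F : free_complex M) i p
    (A : 'M_(p, rank F i.+1)) :
  exact_complex F -> A *m diff F i = 0 -> exists B, A = B *m diff F i.+1.
Proof.
case=> _ _ ex hA.
have /fin_all_exists[w hw] k : exists w, row k A = w *m diff F i.+1.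
  by apply/ex; rewrite -row_mul hA row0.
exists (\matrix_k w k); apply/row_matrixP => k.
by rewrite row_mul rowK.
Qed.

Lemma diff_diff0 (F : free_complex M) i :
  exact_complex F -> diff F i.+1 *m diff F i = 0.
Proof.
case=> _ _ ex; apply/row_matrixP => k; rewrite row_mul row0; apply/ex.
by exists (delta_mx 0 k); rewrite rowE.
Qed.

Lemma augmentation_linear (F : free_complex M) : linear (augmentation F).
Proof.
move=> a u v; rewrite /augmentation scaler_sumr -big_split.
apply: eq_bigr => k _.
by rewrite !mxE scalerDl scalerA.
Qed.

HB.instance Definition _ (F : free_complex M) :=
  GRing.isLinear.Build R _ M _ (augmentation F) (@augmentation_linear F).

Lemma augmentation_row_mul (F G : free_complex M) p
    (A : 'M_(p, rank F 0)) (B : 'M_(rank F 0, rank G 0)) k :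
    (forall l, augmentation G (row l B) = aug F l) ->
  augmentation G (row k (A *m B)) = augmentation F (row k A).
Proof.
move=> hB; rewrite row_mul mulmx_sum_row linear_sum.
by apply: eq_bigr => l _; rewrite linearZ /= hB.
Qed.

Lemma augmentation_lift (F : free_complex M) p (A : 'M_(p, rank F 0)) :
  exact_complex F -> (forall k, augmentation F (row k A) = 0) ->
  exists B, A = B *m diff F 0.
Proof.
case=> _ ex _ hA.
have /fin_all_exists[w hw] k : exists w, row k A = w *m diff F 0.
  by apply/ex; apply: hA.
by exists (\matrix_k w k); apply/row_matrixP => k; rewrite row_mul rowK.
Qed.

Lemma aug_diff0 (F : free_complex M) k :
  exact_complex F -> augmentation F (row k (diff F 0)) = 0.
Proof. by case=> _ ex _; apply/ex; exists (delta_mx 0 k); rewrite rowE. Qed.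

(* The compatibility of the module structure of M with the grading that is
   needed to choose homogeneous coefficients. *)
Hypothesis gr_lift :
  forall r (s : int) (sh : 'I_r -> int) (x : M) (g : 'I_r -> M) (w : 'I_r -> R),
  gr s x -> (forall l, gr (sh l) (g l)) -> x = \sum_l w l *: g l ->
  x = \sum_l hpart (s - sh l) (w l) *: g l.

(** Lift the identity of M to chain maps phi from F to G and psi from G to F,
with phi graded, and compare phi psi with the identity.  A homotopy makes the
difference vanish modulo the variables, by minimality of F; so modulo the
variables phi psi is the identity, and phi, being graded, only connects basis
elements of equal shift.  The maps in the degrees i and i+1 are built together,
by induction on i; e stands for the part of the homotopy coming from below. *)
Lemma resolution_shift (F G : free_complex M) :
  minimal_graded_free_resolution gr F -> minimal_graded_free_resolution gr G ->
  forall i (k : 'I_(rank F i)), exists l : 'I_(rank G i),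
    shift G i l = shift F i k.
Proof.
move=> [[gaF gdF] exF minF] [[gaG gdG] exG minG].
pose sF i := shift F i; pose sG i := shift G i.
have aug_of (H H' : free_complex M) : exact_complex H' ->
    exists A : 'M_(rank H 0, rank H' 0),
      forall k, augmentation H' (row k A) = aug H k.
  case=> surj _ _; have /fin_all_exists[w hw] k := surj (aug H k).
  by exists (\matrix_k w k) => k; rewrite rowK.
have comparison i : exists (phi : 'M_(rank F i, rank G i))
    (psi : 'M_(rank G i, rank F i))
    (h : 'M_(rank F i, rank F i.+1)) (e : 'M_(rank F i))
    (phi' : 'M_(rank F i.+1, rank G i.+1))
    (psi' : 'M_(rank G i.+1, rank F i.+1)),
  [/\ graded_matrix (sF i) (sG i) phi,
      graded_matrix (sF i.+1) (sG i.+1) phi',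
      diff F i *m phi = phi' *m diff G i &
      diff G i *m psi = psi' *m diff F i] /\
  [/\ phi *m psi = 1%:M + h *m diff F i + e, diff F i *m e = 0
      & in_irrelevant e].
  elim: i =>
    [|i [phi [psi [h [e [phi' [psi' [[g g' c c'] [hty de me]]]]]]]]].
    have [A hA] := aug_of F G exG; have [psi hpsi] := aug_of G F exF.
    pose phi := \matrix_(k, l) hpart (sF 0%N k - sG 0%N l) (A k l).
    have gphi : graded_matrix (sF 0%N) (sG 0%N) phi.
      by move=> k l; rewrite mxE; exact: homog_hpart.
    have hphi k : augmentation G (row k phi) = aug F k.
      rewrite (gr_lift (w := fun l => A k l) (gaF k) gaG).
        by apply: eq_bigr => l _; rewrite !mxE.
      by rewrite -hA; apply: eq_bigr => l _; rewrite mxE.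
    have [|phi1 hphi1] := augmentation_lift (A := diff F 0 *m phi) exG.
      by move=> k; rewrite augmentation_row_mul // aug_diff0.
    have [phi' gphi' hphi'] :=
      graded_mulmx_factor (graded_mulmx (gdF 0%N) gphi) (gdG 0%N) hphi1.
    have [|psi' hpsi'] := augmentation_lift (A := diff G 0 *m psi) exF.
      by move=> k; rewrite augmentation_row_mul // aug_diff0.
    have [|h hh] := augmentation_lift (A := phi *m psi - 1%:M) exF.
      move=> k; rewrite linearB linearB /= augmentation_row_mul // hphi.
      rewrite /augmentation (bigD1 k) //= big1 => [|l ne]; rewrite !mxE.
        by rewrite eqxx scale1r addr0 subrr.
      by rewrite eq_sym (negPf ne) scale0r.
    exists phi, psi, h, 0, phi', psi'; do !split=> //.
    - by rewrite addr0 -hh addrC subrK.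
    - by rewrite mulmx0.
    - by move=> k l; rewrite mxE mcoeff0.
  have [|phi1 hphi1] := mulmx_diff_lift (A := diff F i.+1 *m phi') exG.
    by rewrite -mulmxA -c mulmxA diff_diff0 // mul0mx.
  have [phi2 gphi2 hphi2] :=
    graded_mulmx_factor (graded_mulmx (gdF _) g') (gdG _) hphi1.
  have [|psi2 hpsi2] := mulmx_diff_lift (A := diff G i.+1 *m psi') exF.
    by rewrite -mulmxA -c' mulmxA diff_diff0 // mul0mx.
  have [|h' hh'] :=
      mulmx_diff_lift (A := phi' *m psi' - 1%:M - diff F i *m h) exF.
    rewrite !mulmxBl mul1mx -mulmxA -c' mulmxA -c -mulmxA hty.
    rewrite !mulmxDr de addr0 mulmx1 mulmxA.
    by rewrite [_ + _ *m _]addrC addrK subrr.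
  exists phi', psi', h', (diff F i *m h), phi2, psi2; do !split=> //.
  - by rewrite -hh' -addrA subrK addrC subrK.
  - by rewrite mulmxA diff_diff0 // mul0mx.
  - by apply: in_irrelevant_mulmxl; apply: minF.
move=> i k.
have [phi [psi [h [e [phi' [psi' [[g _ _ _] [hty _ me]]]]]]]] := comparison i.
case: (pickP (fun l => sG i l == sF i k)) => [l /eqP eq_sh|no].
  by exists l.
(* No basis element of G in this degree forces the constant terms in row k of
   phi to vanish, while phi *m psi has constant term 1 at (k, k). *)
have /(congr1 (fun A : 'M_(_) => (A k k)@_0%MM)) := hty.
have hm : in_irrelevant (h *m diff F i).
  by apply: in_irrelevant_mulmxr; apply: minF.
rewrite ![(_ + _ : 'M_(_)) k k]mxE !mcoeffD me hm.
rewrite !mxE eqxx !addr0 mcoeff1 eqxx raddf_sum big1 => [/eqP|l _] /=.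
  by rewrite eq_sym oner_eq0.
rewrite [LHS](rmorphM (mcoeff 0)) /=.
suff -> : (phi k l)@_0%MM = 0 by rewrite mul0r.
have := g k l; case E : (sF i k - sG i l) => [d|d] /=; last first.
  by move->; rewrite mcoeff0.
move/(dhomog_nemf_coeff (m := 0%MM)) => -> //.
have : sG i l != sF i k by rewrite no.
by rewrite eq_sym -subr_eq0 E eq_sym mf0.
Qed.

End Uniqueness.

(** * Simplicial chains and cones *)

Section SimplicialChains.
Variables (mu : nat) (A : nzRingType).
Implicit Types (W : {set 'I_mu}) (c : {set 'I_mu} -> A) (u v : 'I_mu).

(** The exponent of the usual simplicial sign of the face W of u |: W, when u is
not in W. *)
Definition position u W := #|[set x in W | (x < u)%N]|.

(** A chain is given by its coefficient function on all vertex sets, of mixed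
dimensions; the value at W collects the contributions of the cofacets of W. *)
Definition boundary c W :=
  \sum_(u | u \notin W) (-1) ^+ position u W * c (u |: W).

Definition cone v c W :=
  if v \in W then (-1) ^+ position v (W :\ v) * c (W :\ v) else 0.

Lemma position_setU1 u v W : v \notin W ->
  position u (v |: W) = ((v < u) + position u W)%N.
Proof.
move=> vW; rewrite /position; case: ltnP => vu.
  have -> : [set x in v |: W | (x < u)%N] = v |: [set x in W | (x < u)%N].
    by apply/setP => x; rewrite !inE; case: eqP => // ->; rewrite vu.
  by rewrite cardsU1 inE (negPf vW).
apply: eq_card => x; rewrite !inE; case: eqP => // ->.
by rewrite (negPf vW) ltnNge vu.
Qed.

Lemma sign_swap u v W : u != v -> u \notin W -> v \notin W ->
  (-1) ^+ (position u (v |: W) + position v (u |: W)) =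
  - ((-1) ^+ (position u W + position v W)) :> A.
Proof.
move=> uv uW vW; rewrite !position_setU1 // addnACA exprD.
suff -> : ((v < u) + (u < v))%N = 1%N by rewrite mulN1r.
have : (u != v :> nat) by [].
by case: ltngtP.
Qed.

(** The cone with apex v is a contracting homotopy of the full simplex, and so
of every subcomplex closed under adding v. *)
Lemma boundary_cone v c W : boundary (cone v c) W = c W - cone v (boundary c) W.
Proof.
rewrite /cone; case: ifPn => [vW|vW]; last first.
  rewrite /boundary (bigD1 v) //= big1 => [|u /andP[_ uv]].
    rewrite setU11 setU1K // mulrA -exprD addnn -mul2n exprM sqrrN expr1n.
    by rewrite expr1n mul1r addr0 subr0.
  by rewrite !inE (negPf vW) eq_sym (negPf uv) mulr0.
have [W0 vW0 ->] : exists2 W0 : {set _}, v \notin W0 & W = v |: W0.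
  by exists (W :\ v); rewrite ?setD1K // !inE eqxx.
rewrite setU1K // /boundary (bigD1 v (P := fun u => u \notin W0)) //=.
rewrite mulrDr mulrA -exprD addnn -mul2n exprM sqrrN expr1n expr1n mul1r opprD.
rewrite addrA subrr add0r mulr_sumr -sumrN.
apply: eq_big => [u|u]; first by rewrite !inE negb_or andbC.
rewrite !inE negb_or eqxx orbT => /andP[uv uW0].
have -> : (u |: (v |: W0)) :\ v = u |: W0.
  by rewrite setUCA setU1K // !inE negb_or eq_sym uv.
by rewrite !mulrA -!exprD sign_swap // mulNr addnC.
Qed.

Lemma boundary_boundary c W : boundary (boundary c) W = 0.
Proof.
pose F u v := (-1) ^+ (position u W + position v (u |: W)) * c (v |: (u |: W)).
have -> : boundary (boundary c) W =
    \sum_(u | u \notin W) \sum_(v | (v \notin W) && (v != u)) F u v.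
  apply: eq_bigr => u uW; rewrite /boundary mulr_sumr.
  apply: eq_big => [v|v _]; first by rewrite !inE negb_or andbC.
  by rewrite mulrA -exprD.
have -> : \sum_(u | u \notin W) \sum_(v | (v \notin W) && (v != u)) F u v =
   \sum_(u | u \notin W) \sum_(v | (v \notin W) && (v < u)%N) F u v +
   \sum_(u | u \notin W) \sum_(v | (v \notin W) && (u < v)%N) F u v.
  rewrite -big_split; apply: eq_bigr => u uW /=.
  rewrite (bigID (fun v : 'I_mu => (v < u)%N)) /=; congr (_ + _).
    apply: eq_bigl => v; rewrite -val_eqE /=; case: (v \notin W) => //=.
    by case: ltngtP.
  apply: eq_bigl => v; rewrite -val_eqE /=; case: (v \notin W) => //=.
  by case: ltngtP.
rewrite [X in _ + X](exchange_big_dep (fun v => v \notin W)) /=; last first.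
  by move=> u v _ /andP[].
rewrite -big_split big1 // => u uW /=.
rewrite [X in X + _](eq_bigr (fun v => - F v u)).
  rewrite sumrN addrC; apply/eqP; rewrite subr_eq0; apply/eqP.
  by apply: eq_bigl => v; rewrite uW.
move=> v /andP[vW vu]; rewrite /F -mulNr setUCA; congr (_ * _).
rewrite !position_setU1 // vu ltnNge (ltnW vu) /= add0n add1n addnS exprS.
by rewrite mulN1r opprK addnC.
Qed.

Lemma eq_boundary c c' W : c =1 c' -> boundary c W = boundary c' W.
Proof. by move=> eq_c; apply: eq_bigr => u _; rewrite eq_c. Qed.

End SimplicialChains.

(** * Resolutions supported on labelled simplicial complexes *)

Section MonomialMultiples.
Variables (K : fieldType) (n : nat).
Implicit Types (p : {mpoly K[n]}) (m : 'X_{1..n}).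

Lemma mpolyX_neq0 m : 'X_[m] != 0 :> {mpoly K[n]}.
Proof.
apply/eqP => /(congr1 (mcoeff m)) /eqP.
by rewrite mcoeffX eqxx mcoeff0 oner_eq0.
Qed.

Lemma mcoeffMX_eq0 p m0 m : ~~ (m0 <= m)%MM -> (p * 'X_[m0])@_m = 0.
Proof.
move=> le; rewrite (mpolyE p) mulr_suml raddf_sum big1 // => m1 _ /=.
rewrite -scalerAl -mpolyXD mcoeffZ mcoeffX.
case: eqP => [mE|]; last by rewrite mulr0.
by case/negP: le; rewrite -mE lem_addl.
Qed.

Lemma monomial_dvdP p m0 : (forall m, p@_m != 0 -> (m0 <= m)%MM) ->
  exists q, p = q * 'X_[m0].
Proof.
move=> dvd; exists (\sum_(m <- msupp p) p@_m *: 'X_[m - m0]).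
rewrite {1}(mpolyE p) mulr_suml big_seq [RHS]big_seq; apply: eq_bigr => m.
by rewrite mcoeff_msupp => /dvd le; rewrite -scalerAl -mpolyXD submK.
Qed.

End MonomialMultiples.

Section QuotientMap.
Variables (K : fieldType) (n : nat) (I : submodClosed {mpoly K[n]}^o).
Local Notation R := {mpoly K[n]}.

Lemma quot_projZ (p q : R) : p *: quot_proj I q = quot_proj I (p * q).
Proof. exact: quot_scale_proj. Qed.

Lemma quot_proj0 (p : R) : quot_proj I p = 0 <-> p \in I.
Proof. by rewrite -[p in p \in I]subr0 -quot_proj_eq /quot_proj raddf0. Qed.

Lemma quot_proj_sum (J : finType) (p : J -> R) :
  quot_proj I (\sum_j p j) = \sum_j quot_proj I (p j).
Proof. by rewrite /quot_proj raddf_sum. Qed.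

End QuotientMap.

(** A simplicial complex D on the generators, with monomial labels L, supports a
free resolution as soon as each subcomplex of the faces with label dividing m
has no vertex or is a cone with apex depending only on m; the resolution is
minimal when removing a vertex from a face always changes the label. *)
Section LabelledComplex.
Variables (K : fieldType) (n mu : nat) (I : submodClosed {mpoly K[n]}^o).
Local Notation R := {mpoly K[n]}.
Variables (D : pred {set 'I_mu}) (L : {set 'I_mu} -> 'X_{1..n}).
Variable apex : 'X_{1..n} -> 'I_mu.
Implicit Types (W : {set 'I_mu}).

Hypothesis D0 : D set0.
Hypothesis D1 : forall j, D [set j].
Hypothesis Dsub : forall W W', W \subset W' -> D W' -> D W.
Hypothesis L0 : L set0 = 0%MM.
Hypothesis Lsub : forall W W', W \subset W' -> (L W <= L W')%MM.
Hypothesis Lmin : forall W u, D W -> u \in W -> L (W :\ u) != L W.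
Hypothesis apexP : forall m j W, (L [set j] <= m)%MM -> D W -> (L W <= m)%MM ->
  D (apex m |: W) /\ (L (apex m |: W) <= m)%MM.
Hypothesis genI : forall p : R,
  p \in I <-> exists w : 'I_mu -> R, p = \sum_j w j * 'X_[L [set j]].

Definition cells i := [set W | D W && (#|W| == i)].

(** At most one summand is nonzero: the one for the vertex u that W has and W'
lacks. *)
Definition incidence W W' : R :=
  \sum_(u | u \notin W')
    (-1) ^+ position u W' * (W == u |: W')%:R * 'X_[L W - L W'].

Definition labelled_complex : free_complex (quot_lmod I) :=
  @FreeComplex K n (quot_lmod I) (fun i => #|cells i|)
    (fun i k => Posz (mdeg (L (enum_val k))))
    (fun i => \matrix_(k, l) incidence (enum_val k) (enum_val l))
    (fun=> quot_proj I 1).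

Local Notation F := labelled_complex.

(** Multiplying each coordinate by the label of its face embeds the labelled
complex in the simplicial chain complex with polynomial coefficients, where the
differential no longer involves labels ([chain_mul]).  The image is cut out by
divisibility by the labels ([chain_onto]), and the multidegree m part is read
off from the coefficients at m. *)
Definition chain i (v : 'rV[R]_#|cells i|) W : R :=
  \sum_k (v 0 k * 'X_[L (enum_val k)]) *+ (enum_val k == W).

Lemma in_cells i W : (W \in cells i) = D W && (#|W| == i).
Proof. by rewrite inE. Qed.

Lemma chain_cell i (v : 'rV[R]_#|cells i|) k :
  chain v (enum_val k) = v 0 k * 'X_[L (enum_val k)].
Proof.
rewrite /chain (bigD1 k) //= eqxx mulr1n big1 ?addr0 // => l lk.
by rewrite (inj_eq enum_val_inj) (negPf lk) mulr0n.
Qed.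

Lemma chain_out i (v : 'rV[R]_#|cells i|) W : W \notin cells i -> chain v W = 0.
Proof.
move=> WD; rewrite /chain big1 // => k _.
case: eqP => [kW|]; last by rewrite mulr0n.
by rewrite -kW enum_valP in WD.
Qed.

Lemma chain_inj i (v w : 'rV[R]_#|cells i|) : chain v =1 chain w -> v = w.
Proof.
move=> eq_vw; apply/rowP => k; have := eq_vw (enum_val k); rewrite !chain_cell.
by apply: mulIf; exact: mpolyX_neq0.
Qed.

Lemma chain_mcoeff i (v : 'rV[R]_#|cells i|) W m :
  (chain v W)@_m != 0 -> [/\ D W, #|W| = i & (L W <= m)%MM].
Proof.
move=> nz; have : W \in cells i.
  by apply: contraNT nz => /chain_out->; rewrite mcoeff0.
move=> Wc; have := Wc; rewrite in_cells => /andP[DW /eqP cW]; split=> //.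
apply: contraNT nz => /mcoeffMX_eq0 mc.
by rewrite -[W](enum_rankK_in Wc) // chain_cell enum_rankK_in // mc.
Qed.

Lemma chain_onto i (c : {set 'I_mu} -> R) :
  (forall W m, (c W)@_m != 0 -> [/\ D W, #|W| = i & (L W <= m)%MM]) ->
  exists v : 'rV[R]_#|cells i|, chain v =1 c.
Proof.
move=> hc.
have /fin_all_exists[q hq] (k : 'I_#|cells i|) :
    exists q, c (enum_val k) = q * 'X_[L (enum_val k)].
  by apply: monomial_dvdP => m /hc[].
exists (\row_k q k) => W; have [Wc|Wc] := boolP (W \in cells i).
  by rewrite -[W](enum_rankK_in Wc) // chain_cell mxE hq.
rewrite chain_out //; apply/esym/mpolyP => m; rewrite mcoeff0; apply/eqP.
by apply: contraNT Wc => /hc[DW cW _]; rewrite in_cells DW cW eqxx.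
Qed.

Lemma cells_setU1 i u W :
  u \notin W -> u |: W \in cells i.+1 -> W \in cells i.
Proof.
rewrite !in_cells cardsU1 => -> /andP[DW]; rewrite add1n eqSS => ->.
by rewrite (Dsub _ DW) // subsetUr.
Qed.

Lemma chain_mul i (v : 'rV[R]_#|cells i.+1|) :
  chain (v *m diff F i) =1 boundary (chain v).
Proof.
move=> W; have [Wc|Wc] := boolP (W \in cells i); last first.
  rewrite chain_out // /boundary big1 // => u uW.
  by rewrite chain_out ?mulr0 //; apply: contra Wc; apply: cells_setU1.
rewrite -[W](enum_rankK_in Wc) // chain_cell enum_rankK_in // mxE mulr_suml.
rewrite /boundary /chain.
under [RHS]eq_bigr do rewrite mulr_sumr.
rewrite [RHS]exchange_big /=; apply: eq_bigr => k _.
rewrite !mxE enum_rankK_in // /incidence mulr_sumr mulr_suml.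
apply: eq_bigr => u uW.
case: eqP => [->|_]; last by rewrite !(mulr0, mul0r, mulr0n).
rewrite mulr1 mulr1n -!mulrA -mpolyXD submK; last by rewrite Lsub ?subsetUr.
by rewrite mulrCA.
Qed.

(** A cycle is filled one multidegree at a time, by coning its coefficients at m
from the apex attached to m. *)
Lemma labelled_complex_exact_pos i (v : 'rV_(rank F i.+1)) :
  v *m diff F i = 0 <-> exists w, v = w *m diff F i.+1.
Proof.
split=> [dv0 | [w ->]]; last first.
  apply: chain_inj => W; rewrite chain_mul (eq_boundary _ (chain_mul w)).
  by rewrite boundary_boundary /chain big1 // => k _; rewrite mxE mul0r mul0rn.
pose c := chain v.
have bd0 W : boundary c W = 0.
  by rewrite -chain_mul dv0 /chain big1 // => k _; rewrite mxE mul0r mul0rn.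
pose cm m W := (c W)@_m.
have bdcm m W : boundary (cm m) W = 0.
  rewrite -[RHS](mcoeff0 K m) -(bd0 W) /boundary raddf_sum.
  by apply: eq_bigr => u _; rewrite raddfMsign.
(* N bounds the degrees that occur, which makes b W a polynomial. *)
pose N := (\max_W msize (c W))%N.
pose b W : R := \sum_(m : 'X_{1..n < N}) cone (apex m) (cm m) W *: 'X_[m].
have bE W m : (b W)@_m = cone (apex m) (cm m) W.
  have [mN|Nm] := ltnP (mdeg m) N.
    exact: (mcoeff_mpoly (fun m => cone (apex m) (cm m) W) mN).
  have -> : cone (apex m) (cm m) W = 0.
    rewrite /cone; case: ifP => // _; rewrite /cm memN_msupp_eq0 ?mulr0 //.
    by apply: msize_mdeg_ge; apply: leq_trans Nm; rewrite /N leq_bigmax.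
  rewrite raddf_sum big1 // => -[m' /= m'N] _.
  rewrite mcoeffZ mcoeffX; case: eqP => [mm|_]; last by rewrite mulr0.
  by move: m'N; rewrite mm ltnNge Nm.
have [|w hw] := @chain_onto i.+2 b.
  move=> W m; rewrite bE /cone; case: ifP => [aW|_]; last by rewrite eqxx.
  move=> nz; have : cm m (W :\ apex m) != 0.
    by apply: contraNneq nz => ->; rewrite mulr0.
  move=> /chain_mcoeff[DW cW LW].
  (* A face of dimension at least 0 has a vertex, so that m lies in the ideal
     and its apex is meaningful. *)
  have /card_gt0P[j jW] : (0 < #|W :\ apex m|)%N by rewrite cW.
  have Lj : (L [set j] <= m)%MM.
    by apply: lepm_trans LW; rewrite Lsub // sub1set.
  have [] := apexP Lj DW LW; rewrite setD1K // => -> ->; split=> //.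
  by rewrite (cardsD1 (apex m)) aW cW.
exists w; apply: chain_inj => W; rewrite chain_mul (eq_boundary _ hw).
apply/mpolyP => m.
have -> : (boundary b W)@_m = boundary (cone (apex m) (cm m)) W.
  rewrite /boundary raddf_sum; apply: eq_bigr => u _.
  by rewrite /= raddfMsign /= bE.
by rewrite boundary_cone /cone bdcm mulr0 if_same subr0.
Qed.

Lemma augmentation_labelled (v : 'rV_(rank F 0)) :
  augmentation F v = quot_proj I (chain v set0).
Proof.
rewrite /augmentation /chain quot_proj_sum; apply: eq_bigr => k _ /=.
have /[!in_cells]/andP[_] := enum_valP k.
rewrite cards_eq0 => /eqP ->.
by rewrite L0 mpolyX0 !mulr1 quot_projZ mulr1 eqxx.
Qed.

Lemma boundary_set0 (c : {set 'I_mu} -> R) : boundary c set0 = \sum_j c [set j].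
Proof.
rewrite /boundary; apply: eq_big => [j|j _]; first by rewrite inE.
have -> : position j set0 = 0%N by apply: eq_card0 => x; rewrite !inE.
by rewrite setU0 mul1r.
Qed.

Lemma labelled_complex_exact : exact_complex F.
Proof.
split=> [x|v|i v]; last exact: labelled_complex_exact_pos.
  have [p ->] := quot_projP x.
  have [|v hv] := @chain_onto 0 (fun W => if W == set0 then p else 0).
    move=> W m; have [->|_] := eqVneq W set0; last by rewrite mcoeff0 eqxx.
    by rewrite cards0 L0 D0 => _; split=> //; apply/mnm_lepP=> i; rewrite mnm0E.
  by exists v; rewrite augmentation_labelled hv eqxx.
rewrite augmentation_labelled quot_proj0 genI; split=> [[q vq]|[w ->]].
  pose c W := \sum_j (q j * 'X_[L [set j]]) *+ (W == [set j]).
  have [|w hw] := @chain_onto 1 c.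
    move=> W m nz; case: (pickP (fun j => W == [set j])) => [j /eqP Wj|no].
      rewrite Wj cards1 D1; split=> //; apply: contraNT nz => Ljm.
      rewrite /c (bigD1 j) //= big1 => [|k kj].
        by rewrite Wj eqxx mulr1n addr0 mcoeffMX_eq0.
      by rewrite Wj (inj_eq set1_inj) eq_sym (negPf kj).
    by case/eqP: nz; rewrite /c big1 ?mcoeff0 // => j _; rewrite no.
  exists w; apply: chain_inj => W; rewrite chain_mul.
  have [->|W0] := eqVneq W set0; last first.
    rewrite -chain_mul !chain_out // in_cells cards_eq0 negb_and W0 orbT //.
  rewrite boundary_set0 vq; apply: eq_bigr => j _; rewrite hw /c.
  rewrite (bigD1 j) //= big1 ?eqxx ?addr0 // => k kj.
  by rewrite (inj_eq set1_inj) eq_sym (negPf kj).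
rewrite chain_mul boundary_set0.
have wj j : exists q, chain w [set j] = q * 'X_[L [set j]].
  by apply: monomial_dvdP => m /chain_mcoeff[].
have [q hq] := fin_all_exists wj.
by exists q; apply: eq_bigr => j _; rewrite hq.
Qed.

Lemma incidence_homog W W' :
  homog_of_degree (Posz (mdeg (L W)) - Posz (mdeg (L W'))) (incidence W W').
Proof.
apply: homog_of_degree_sum => u uW'; case: eqP => [WE|_]; last first.
  by rewrite mulr0 mul0r; case: (_ - _) => // d; apply: dhomog0.
have le : (L W' <= L W)%MM by rewrite Lsub // WE subsetUr.
rewrite -{1}(submK le) mdegD PoszD addrK /= mulr1.
by rewrite -signr_odd; case: odd; rewrite ?mulN1r ?dhomogN ?mul1r dhomogX.
Qed.

Theorem labelled_complex_minimal_resolution :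
  minimal_graded_free_resolution (@quot_grading K n I) F.
Proof.
split; [split=> [k|i k l] | exact: labelled_complex_exact | move=> i k l].
- exists 1 => //=; have /[!in_cells]/andP[_] := enum_valP k.
  by rewrite cards_eq0 => /eqP ->; rewrite L0 mdeg0 dhomog1.
- by rewrite mxE; apply: incidence_homog.
rewrite mxE raddf_sum big1 // => u uW'; case: eqP => [WE|_] /=; last first.
  by rewrite mulr0 mul0r mcoeff0.
set W := enum_val k in WE *; set W' := enum_val l in uW' WE *.
rewrite mulr1 raddfMsign /= mcoeffX.
case: eqP => [L_eq|]; last by rewrite mulr0.
have /[!in_cells]/andP[DW _] := enum_valP k.
have /negP[] : L (W :\ u) != L W by apply: Lmin => //; rewrite WE setU11.
have le : (L W' <= L W)%MM by rewrite Lsub // WE subsetUr.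
by rewrite -[L W](submK le) L_eq add0m WE setU1K.
Qed.

End LabelledComplex.

(** * Neighborhood-free vertex sets *)

Section NeighborhoodFreeSets.
Variables (A V : finType) (E : A -> {set V}).
Implicit Types (v w u : V) (W : {set V}) (a : A).

Lemma hg_closedP v : reflect (exists a, E a = [set v]) (hg_closed E v).
Proof.
apply: (iffP imsetP) => [[a _ ->]|[a Ea]]; first by exists a.
by exists a.
Qed.

Lemma hg_neighborsP v w :
  reflect (exists a, [/\ w != v, v \in E a & w \in E a])
    (w \in hg_neighbors E v).
Proof.
rewrite inE; apply: (iffP andP) => [[wv /existsP[F]]|[a [wv va wa]]].
  by case/andP => /imsetP[a _ ->] /andP[va wa]; exists a.
split=> //; apply/existsP; exists (E a); rewrite va wa !andbT.
exact: imset_f.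
Qed.

Lemma hg_dim1_card a : hg_dim E = 1 -> (#|E a| <= 2)%N.
Proof.
rewrite /hg_dim => /eqP; rewrite subr_eq => /eqP [max2].
have : (#|E a| <= \max_(F in hg_edges E) #|F|)%N.
  by apply: (leq_bigmax_cond (F := fun F : {set V} => #|F|)); apply: imset_f.
by rewrite max2.
Qed.

Lemma open_label_neighbor v a : hg_open E v -> v \in E a ->
  exists2 w, w \in hg_neighbors E v & w \in E a.
Proof.
move=> ov va; case: (pickP [pred w in E a | w != v]) => [w /andP[wa wv]|no].
  by exists w => //; apply/hg_neighborsP; exists a.
case/negP: ov; apply/hg_closedP; exists a; apply/setP => w; rewrite inE.
have := no w => /=; case: eqP => [->|_]; first by rewrite va.
by rewrite andbT.
Qed.

Definition nbhd_free W :=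
  [forall v, hg_open E v ==> ~~ (hg_neighbors E v \subset W)].

Lemma nbhd_freeP W :
  reflect (forall v, hg_open E v -> ~~ (hg_neighbors E v \subset W))
    (nbhd_free W).
Proof. by apply: (iffP forallP) => h v; [apply/implyP | apply/implyP/h]. Qed.

Lemma nbhd_free_sub W W' : W \subset W' -> nbhd_free W' -> nbhd_free W.
Proof.
move=> sub /nbhd_freeP h; apply/nbhd_freeP => v /h.
by apply: contra => /subset_trans; apply.
Qed.

Definition covered_labels W := [set a | E a :&: W != set0].

Lemma card_labels_split W :
  #|hg_labels E| =
    (#|covered_labels W| + #|[set a in hg_labels E | E a \subset ~: W]|)%N.
Proof.
rewrite -(cardsID (covered_labels W)); congr (_ + _)%N; apply: eq_card => a.
  rewrite !inE; have [->|//] := eqVneq (E a) set0.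
  by rewrite set0I eqxx.
by rewrite !inE negbK setI_eq0 disjoints_subset andbC.
Qed.

(** Independence forces every label inside U to be a singleton. *)
Lemma card_labels_inside_independent (U : {set V}) :
  {in U &, forall u w, u \notin hg_neighbors E w} ->
  (forall u a b, u \in U -> E a = [set u] -> E b = [set u] -> a = b) ->
  (#|[set a in hg_labels E | E a \subset U]| <= #|U|)%N.
Proof.
move=> indep uniq_label; set Y := [set a in _ | _].
have single a : a \in Y -> exists2 u, u \in U & E a = [set u].
  rewrite !inE => /andP[/set0Pn[u ua] /subsetP aU].
  exists u; first exact: aU.
  apply/setP => w; rewrite inE; apply/idP/eqP => [wa|->//].
  apply/eqP; apply: contraT => wu; case/negP: (indep w u (aU w wa) (aU u ua)).
  by apply/hg_neighborsP; exists a.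
rewrite -(card_in_imset (f := E) (D := Y)).
  rewrite -(card_imset U set1_inj); apply/subset_leq_card/subsetP.
  by move=> _ /imsetP[a /single[u uU ->] ->]; apply: imset_f.
move=> a b /single[u uU Ea] _ eqE; apply: (uniq_label u) => //.
by rewrite -eqE.
Qed.

Hypothesis card_label : forall a, (#|E a| <= 2)%N.
Hypothesis isolated : open_vertices_isolated E.

Lemma label_pair a v w : v \in E a -> w \in E a -> v != w -> E a = [set v; w].
Proof.
move=> va wa vw; apply/esym/eqP; rewrite eqEcard subUset !sub1set va wa /=.
by rewrite cards2 vw card_label.
Qed.

(** If u is closed, its own label {u} works; if u is open, some neighbor x lies
outside W and the label {u, x}, having no third vertex, works.  This makes the
resolution minimal. *)
Lemma nbhd_free_private_label W u : nbhd_free W -> u \in W ->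
  exists a, E a :&: W = [set u].
Proof.
move=> /nbhd_freeP fW uW.
case: (boolP (hg_closed E u)) => [/hg_closedP[a Ea]|ou].
  by exists a; rewrite Ea; apply/setIidPl; rewrite sub1set.
have /subsetPn[x /hg_neighborsP[a [xu ua xa]] xW] := fW u ou.
exists a; rewrite (label_pair ua xa); last by rewrite eq_sym.
rewrite setIUl (setIidPl _) ?sub1set // -[RHS]setU0; congr (_ :|: _).
by apply: disjoint_setI0; rewrite disjoints1.
Qed.

Hypothesis vertex_label : forall v, exists a, v \in E a.

(** Attach to a closed vertex u outside W the label {u}, and to an open one a
label {u, x} with x outside W; such an x is closed, so u can be recovered from
its label. *)
Lemma card_labels_inside_complement W : nbhd_free W ->
  (#|~: W| <= #|[set a in hg_labels E | E a \subset ~: W]|)%N.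
Proof.
move=> /nbhd_freeP fW.
pose P u a := [/\ u \in E a, E a \subset ~: W,
  forall x, x \in E a -> hg_open E x -> x = u & hg_closed E u -> E a = [set u]].
have /fin_all_exists[tau htau] u : exists a, u \in ~: W -> P u a.
  case: (boolP (u \in ~: W)) => [uW|_]; last first.
    by have [a _] := vertex_label u; exists a.
  case: (boolP (hg_closed E u)) => [/[dup] cu /hg_closedP[a Ea]|ou].
    exists a => _; split=> //; rewrite Ea ?inE ?sub1set //.
    by move=> x; rewrite inE => /eqP ->.
  have /subsetPn[x xN xW] := fW u ou.
  have cx := isolated ou xN.
  have /hg_neighborsP[a [xu ua xa]] := xN.
  exists a => _; split=> //; last by move=> cu; rewrite /hg_open cu in ou.
    by rewrite (label_pair ua xa) 1?eq_sym // subUset !sub1set uW inE xW.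
  move=> y; rewrite (label_pair ua xa) 1?eq_sym // !inE.
  case/orP => [/eqP //|/eqP ->]; by rewrite /hg_open cx.
rewrite -(card_in_imset (f := tau) (D := ~: W)) => [|u u' uW u'W tE].
  apply/subset_leq_card/subsetP => _ /imsetP[u uW ->].
  have [ua aW _ _] := htau u uW; rewrite !inE aW andbT.
  by apply/set0Pn; exists u.
have [ua _ op _] := htau u uW; have [u'a _ _ cl] := htau u' u'W.
rewrite -tE in u'a cl.
case: (boolP (hg_closed E u')) => [/cl Ea|ou'].
  by apply/set1P; rewrite -Ea.
by apply/esym/op.
Qed.

Lemma nbhd_free_excess W : nbhd_free W ->
  (#|covered_labels W| + #|V| <= #|hg_labels E| + #|W|)%N.
Proof.
move=> /card_labels_inside_complement le.
have := card_labels_split W; have := cardsC W; lia.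
Qed.

Lemma nbhd_free_excess_eq (U : {set V}) : nbhd_free (~: U) ->
  {in U &, forall u w, u \notin hg_neighbors E w} ->
  (forall u a b, u \in U -> E a = [set u] -> E b = [set u] -> a = b) ->
  (#|covered_labels (~: U)| + #|V| = #|hg_labels E| + #|~: U|)%N.
Proof.
move=> fU indep uniq; have := card_labels_inside_independent indep uniq.
have := card_labels_inside_complement fU; rewrite setCK => ge le.
have inside : #|[set a in hg_labels E | E a \subset U]| = #|U|.
  by apply/eqP; rewrite eqn_leq le ge.
by rewrite (card_labels_split (~: U)) setCK inside -(cardsC U) addnA.
Qed.

End NeighborhoodFreeSets.

(** * Monomial ideals and the Betti numbers of their quotients *)

Section MonomialIdeals.
Variables (K : fieldType) (n : nat) (I : {pred {mpoly K[n]}}).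
Local Notation R := {mpoly K[n]}.

Lemma monomial_in_ideal (S : 'X_{1..n} -> Prop) m :
  monomials_generate I S -> ('X_[m] : R) \in I -> exists2 s, S s & (s <= m)%MM.
Proof.
move=> gen /gen[k [s [c [Ss mE]]]].
case: (pickP (fun i => (s i <= m)%MM)) => [i sm|no]; first by exists (s i).
have /(congr1 (mcoeff m))/eqP := mE; rewrite mcoeffX eqxx raddf_sum big1.
  by rewrite oner_eq0.
by move=> i _; rewrite /= mcoeffMX_eq0 // no.
Qed.

Lemma generator_in_ideal (S : 'X_{1..n} -> Prop) m :
  monomials_generate I S -> S m -> ('X_[m] : R) \in I.
Proof.
move=> gen Sm; apply/gen; exists 1%N, (fun=> m), (fun=> 1).
by split=> //; rewrite big_ord1 mul1r.
Qed.

Lemma monomials_generate_family mu (f : 'I_mu -> 'X_{1..n}) :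
  monomials_generate I (fun m => exists j, m = f j) ->
  forall p : R, p \in I <-> exists w : 'I_mu -> R, p = \sum_j w j * 'X_[f j].
Proof.
move=> gen p; split=> [/gen[k [s [c [Ss ->]]]]|[w ->]]; last first.
  by apply/gen; exists mu, f, w; split=> // i; exists i.
have /fin_all_exists[J hJ] := Ss.
exists (fun j => \sum_(i | J i == j) c i).
rewrite (partition_big J xpredT) //=; apply: eq_bigr => j _.
by rewrite mulr_suml; apply: eq_bigr => i /eqP <-; rewrite hJ.
Qed.

(** Were f i a proper divisor of f j, the multiples of f j could be rewritten as
multiples of f i and the other generators would suffice. *)
Lemma minimal_generators_antichain mu (f : 'I_mu -> 'X_{1..n}) i j :
  minimal_monomial_generators I f -> (f i <= f j)%MM -> i = j.
Proof.
move=> [_ gen min] le; apply/eqP; apply: contraT => ij.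
case: (min (~: [set j])).
  by rewrite properT; apply/eqP => /setP/(_ j); rewrite !inE eqxx.
move=> p; split=> [/(monomials_generate_family gen)[w ->]|].
  exists mu, (fun a => if a == j then f i else f a),
    (fun a => w a * (if a == j then 'X_[f j - f i] else 1)); split=> [a|].
    case: eqP => [_|/eqP aj]; [exists i | exists a] => //; rewrite !inE //.
  apply: eq_bigr => a _; case: eqP => [->|_]; last by rewrite mulr1.
  by rewrite -mulrA -mpolyXD submK.
move=> [k [s [c [Ss pE]]]]; apply/gen; exists k, s, c; split=> // a.
by have [b _ ->] := Ss a; exists b.
Qed.

(** f j is a multiple of one of the square-free generators, which is in turn a
multiple of some f k; then k = j and f j is that square-free monomial. *)
Lemma minimal_generators_squarefree mu (f : 'I_mu -> 'X_{1..n}) j :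
  squarefree_monomial_ideal I -> minimal_monomial_generators I f ->
  squarefree (f j).
Proof.
move=> [S [sqS genS]] minf a; have [_ gen _] := minf.
have [|s Ss sj] := monomial_in_ideal (m := f j) genS.
  by apply: generator_in_ideal gen _; exists j.
have [_ [k ->] ks] := monomial_in_ideal gen (generator_in_ideal genS Ss).
have <- := minimal_generators_antichain minf (lepm_trans ks sj).
exact: leq_trans (mnm_lepP ks a) (sqS s Ss a).
Qed.

End MonomialIdeals.

Section QuotientGrading.
Variables (K : fieldType) (n : nat) (I : submodClosed {mpoly K[n]}^o).
Local Notation R := {mpoly K[n]}.

Lemma quot_grading_lift :
  (forall s (p : R), p \in I -> hpart s p \in I) ->
  forall r (s : int) (sh : 'I_r -> int) (x : quot_lmod I)
    (g : 'I_r -> quot_lmod I) (w : 'I_r -> R),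
  quot_grading s x -> (forall l, quot_grading (sh l) (g l)) ->
  x = \sum_l w l *: g l -> x = \sum_l hpart (s - sh l) (w l) *: g l.
Proof.
move=> homogI r s sh x g w [p hp ->] hg.
have /fin_all_exists2[q hq gq] := hg.
have projZ (c : 'I_r -> R) :
    \sum_l c l *: g l = quot_proj I (\sum_l c l * q l).
  rewrite quot_proj_sum; apply: eq_bigr => l _.
  by rewrite gq quot_projZ.
move=> pE; apply: (etrans _ (esym (projZ _))).
have /quot_proj_eq/(homogI s) := etrans pE (projZ _).
rewrite linearB /= hpart_id // => pI.
apply/quot_proj_eq; move: pI; rewrite linear_sum /=; congr (_ - _ \in I).
by apply: eq_bigr => l _; rewrite /= (hpartM _ _ (hq l)).
Qed.

Lemma monomial_ideal_hpart mu (f : 'I_mu -> 'X_{1..n}) :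
  (forall p : R, p \in I <-> exists w, p = \sum_j w j * 'X_[f j]) ->
  forall s (p : R), p \in I -> hpart s p \in I.
Proof.
move=> gen s p /gen[w ->]; apply/gen.
exists (fun j => hpart (s - Posz (mdeg (f j))) (w j)).
rewrite linear_sum; apply: eq_bigr => j _ /=.
by rewrite (hpartM _ _ (homog_of_degreeX _ _)).
Qed.

(** The Betti numbers count shifts in a chosen minimal graded resolution; as the
set of shifts does not depend on the choice, F may replace it. *)
Lemma betti_neq0 (F : free_complex (quot_lmod I)) i j :
  (forall s (p : R), p \in I -> hpart s p \in I) ->
  minimal_graded_free_resolution (@quot_grading K n I) F ->
  betti (@quot_grading K n I) i j != 0%N <-> exists k, shift F i k = j.
Proof.
move=> homogI minF.
have lift := quot_grading_lift homogI.
have minG : minimal_graded_free_resolution (@quot_grading K n I)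
    (min_resolution (@quot_grading K n I)).
  by apply: epsilon_spec; exists F.
rewrite /betti -lt0n; split=> [/card_gt0P[k]|[k <-]].
  rewrite inE => /eqP <-; exact: (resolution_shift lift minG minF k).
have [l hl] := resolution_shift lift minF minG k.
by apply/card_gt0P; exists l; rewrite inE hl.
Qed.

End QuotientGrading.

(** * The cone structure in each multidegree *)

Section LcmLabels.
Variables (n mu : nat) (f : 'I_mu -> 'X_{1..n}).
Local Notation E := (label_map f).

(** The least common multiple of the generators f j with j in W, in the case of
square-free generators ([lcm_label_leP]). *)
Definition lcm_label (W : {set 'I_mu}) : 'X_{1..n} :=
  [multinom nat_of_bool (E a :&: W != set0) | a < n].

Lemma mdeg_lcm_label W : mdeg (lcm_label W) = #|covered_labels E W|.
Proof.
rewrite mdegE -sum1_card [RHS]big_mkcond; apply: eq_bigr => a _.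
by rewrite mnmE inE; case: (_ == _).
Qed.

Lemma lcm_label0 : lcm_label set0 = 0%MM.
Proof. by apply/mnmP => a; rewrite mnmE mnm0E setI0 eqxx. Qed.

Lemma lcm_label_sub (W W' : {set 'I_mu}) :
  W \subset W' -> (lcm_label W <= lcm_label W')%MM.
Proof.
move=> sub; apply/mnm_lepP => a; rewrite !mnmE.
case: eqP => //= /eqP/set0Pn[x]; rewrite inE => /andP[xa xW].
have -> // : E a :&: W' != set0.
by apply/set0Pn; exists x; rewrite inE xa (subsetP sub).
Qed.

Hypothesis squarefree_f : forall j, squarefree (f j).

Lemma squarefreeE j a : f j a = nat_of_bool (j \in E a).
Proof.
by rewrite inE lep1mP; have := squarefree_f j a; case: (f j a) => [|[]].
Qed.

Lemma lcm_label1 j : lcm_label [set j] = f j.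
Proof.
apply/mnmP => a; rewrite mnmE squarefreeE setI_eq0 disjoint_sym disjoints1.
by rewrite negbK.
Qed.

Lemma lcm_label_leP (W : {set 'I_mu}) m :
  reflect {in W, forall j, (f j <= m)%MM} (lcm_label W <= m)%MM.
Proof.
apply: (iffP idP) => [le j jW|h].
  by rewrite -lcm_label1 (lepm_trans _ le) // lcm_label_sub // sub1set.
apply/mnm_lepP => a; rewrite mnmE; case: eqP => //= /eqP/set0Pn[j].
rewrite inE => /andP[ja jW]; have /mnm_lepP/(_ a) := h j jW.
by rewrite squarefreeE ja.
Qed.

End LcmLabels.

Section ConeApex.
Variables (n mu : nat) (f : 'I_mu -> 'X_{1..n}) (j0 : 'I_mu).
Local Notation E := (label_map f).
Hypothesis squarefree_f : forall j, squarefree (f j).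
Hypothesis isolated : open_vertices_isolated E.

(** An open vertex is preferred, since adding it never completes the
neighborhood of an open vertex; the value j0 is taken only for m outside the
ideal. *)
Definition cone_apex (m : 'X_{1..n}) : 'I_mu :=
  if [pick v | hg_open E v && (f v <= m)%MM] is Some v then v
  else odflt j0 [pick v | (f v <= m)%MM].

Lemma cone_apexP m j W : (f j <= m)%MM -> nbhd_free E W ->
  (lcm_label f W <= m)%MM ->
  nbhd_free E (cone_apex m |: W) /\ (lcm_label f (cone_apex m |: W) <= m)%MM.
Proof.
move=> jm fW /(lcm_label_leP squarefree_f) Wm.
have am : (f (cone_apex m) <= m)%MM.
  rewrite /cone_apex; case: pickP => [v /andP[]//|_].
  by case: pickP => [v //|/(_ j)]; rewrite jm.
have aWm : {in cone_apex m |: W, forall i, (f i <= m)%MM}.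
  by move=> i /setU1P[->|/Wm].
split; last exact/lcm_label_leP.
apply/nbhd_freeP => v ov; apply/negP => /subsetP Nv.
move: Nv aWm; rewrite /cone_apex; case: pickP => [u /andP[ou _] Nv _|no Nv].
  case/negP: (nbhd_freeP _ _ fW v ov); apply/subsetP => w wN.
  have /setU1P[wu|//] := Nv w wN.
  by move: ou; rewrite /hg_open -wu (isolated ov wN).
move=> aWm; have /negP[] := negbT (no v); rewrite ov /=.
apply/mnm_lepP => a; rewrite squarefreeE //.
case: (boolP (v \in E a)) => //= va.
have [w wN wa] := open_label_neighbor ov va.
by have /mnm_lepP/(_ a) := aWm w (Nv w wN); rewrite squarefreeE // wa.
Qed.

End ConeApex.

Theorem corollary5p3 (K : fieldType) (n : nat)
  (I : submodClosed {mpoly K[n]}^o)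
  (hI : squarefree_monomial_ideal I)
  (mu : nat) (f : 'I_mu -> 'X_{1..n})
  (hf : minimal_monomial_generators I f)
  (hdim : hg_dim (label_map f) = 1)
  (t : nat) (c : 'I_t -> 'I_mu)
  (hclosed : forall i, hg_closed (label_map f) (c i))
  (h1 : forall i j : 'I_t, (i < j)%N ->
     c i \notin hg_neighbors (label_map f) (c j))
  (h2 : forall v, hg_open (label_map f) v ->
     exists i, c i \in hg_neighbors (label_map f) v)
  (h3 : forall i, exists! a,
     a \in hg_labels (label_map f) /\ label_map f a = [set c i])
  (h4 : open_vertices_isolated (label_map f)) :
  is_reg (@quot_grading K n I)
    (Posz #|hg_labels (label_map f)| - Posz #|'I_mu|).
Proof.
set E := label_map f.
have cardE a : (#|E a| <= 2)%N by apply: hg_dim1_card.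
have sqf j : squarefree (f j) by apply: minimal_generators_squarefree hI hf.
have [_ gen0 _] := hf; have gen := monomials_generate_family gen0.
have homogI := monomial_ideal_hpart gen.
have vertex_label v : exists a, v \in E a.
  case: (boolP (hg_closed E v)) =>
    [/hg_closedP[a Ea]|/h2[i /hg_neighborsP[a []]]].
    by exists a; rewrite Ea inE.
  by exists a.
have [j0 _] : exists j : 'I_mu, True.
  case: (pickP (fun j : 'I_mu => true)) => [j _|no]; first by exists j.
  have : hg_dim E = -1.
    rewrite /hg_dim big1 ?sub0r // => F _; apply: eq_card0 => j.
    by have := no j.
  by rewrite hdim.
have free1 j : nbhd_free E [set j].
  apply/nbhd_freeP => v ov; apply/negP => /subsetP Nv.
  have [i ciN] := h2 v ov; have /set1P cij := Nv _ ciN.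
  have /hg_neighborsP[_ [/eqP cv _ _]] := ciN; apply: cv; rewrite cij.
  apply/esym/(minimal_generators_antichain hf)/mnm_lepP => a.
  rewrite !squarefreeE //; case: (boolP (v \in _)) => // va.
  have [w /Nv/set1P -> wj] := open_label_neighbor ov va.
  by rewrite wj.
pose F := labelled_complex I (nbhd_free E) (lcm_label f).
have minF : minimal_graded_free_resolution (@quot_grading K n I) F.
  apply: (@labelled_complex_minimal_resolution _ _ _ _ _ _ (cone_apex f j0)).
  - by apply: nbhd_free_sub (free1 j0); rewrite sub0set.
  - exact: free1.
  - exact: nbhd_free_sub.
  - exact: lcm_label0.
  - exact: lcm_label_sub.
  - move=> W u fW uW; apply/eqP => /mnmP.
    have [a Ea] := nbhd_free_private_label cardE fW uW.
    move/(_ a); rewrite !mnmE -/E Ea.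
    have -> : E a :&: (W :\ u) = set0 by rewrite setIDA Ea setDv.
    by rewrite eqxx -cards_eq0 cards1.
  - by move=> m j W; rewrite lcm_label1 //; apply: cone_apexP.
  - by move=> p; rewrite gen; split=> -[w ->]; exists w; apply: eq_bigr => j _;
      rewrite lcm_label1.
have shiftP i j : betti (@quot_grading K n I) i j != 0%N <->
    exists2 W, nbhd_free E W /\ #|W| = i & j = Posz #|covered_labels E W|.
  rewrite (betti_neq0 _ _ homogI minF); split=> [[k <-]|[W [fW cW] ->]].
    have /[!in_cells]/andP[fW /eqP cW] := enum_valP k.
    by exists (enum_val k) => //; rewrite /= mdeg_lcm_label.
  have Wc : W \in cells (nbhd_free E) i by rewrite in_cells fW cW eqxx.
  by exists (enum_rank_in Wc W); rewrite /= enum_rankK_in // mdeg_lcm_label.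
have excess a v x w : (a + v <= x + w)%N -> Posz a - Posz w <= Posz x - Posz v.
  lia.
split=> [|i j /shiftP[W [fW <-] ->]]; last first.
  exact/excess/(nbhd_free_excess cardE h4 vertex_label fW).
pose U := [set c i | i : 'I_t].
have fU : nbhd_free E (~: U).
  apply/nbhd_freeP => v ov; have [i ciN] := h2 v ov.
  by apply/subsetPn; exists (c i) => //; rewrite inE negbK imset_f.
have indepU : {in U &, forall u w, u \notin hg_neighbors E w}.
  have sym v w : v \in hg_neighbors E w -> w \in hg_neighbors E v.
    move/hg_neighborsP => [a [vw wa va]]; apply/hg_neighborsP.
    by exists a; rewrite eq_sym.
  move=> _ _ /imsetP[i _ ->] /imsetP[j _ ->].
  have [/h1 //|ji|ij] := ltngtP i j.
    by apply: contra (h1 _ _ ji); apply: sym.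
  by rewrite (val_inj ij) inE eqxx.
have uniqU u a b : u \in U -> E a = [set u] -> E b = [set u] -> a = b.
  move=> /imsetP[i _ ->] Ea Eb; have [a0 [_ uniq0]] := h3 i.
  have lab x : E x = [set c i] -> x \in hg_labels E.
    by move=> Ex; rewrite inE Ex -cards_eq0 cards1.
  by rewrite -(uniq0 a) ?(uniq0 b) //; split=> //; exact: lab.
have eqU := nbhd_free_excess_eq cardE h4 vertex_label fU indepU uniqU.
exists #|~: U|, (Posz #|covered_labels E (~: U)|); split.
  by apply/shiftP; exists (~: U).
have excess_eq a v x w : (a + v = x + w)%N -> Posz x - Posz v = Posz a - Posz w.
  lia.
exact: excess_eq eqU.
Qed.
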